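(* Let $\tau>0$ and let $\{(\rho^n,\phi^n)\}_{n\ge0}$ be defined by $\rho^0=\rho^{in}\in[\mathcal P(\Omega)]^s$, $\phi^0$ such that $(\rho^0,\phi^0)\in\mathcal A$, and $$(\rho^{n+1},\phi^{n+1})=\arg\min_{(\rho,\phi)\in\mathcal A}\Big\{\frac1{2\tau}d^2(\rho^n,\rho)+E(\rho,\phi)\Big\},\qquad n\ge0,$$ where $d^2$, $E$ and $\mathcal A$ are defined in the context. Then: (i) (Probability-preserving) If $\rho^n\in[\mathcal P(\Omega)]^s$, then $\rho^{n+1}\in[\mathcal P(\Omega)]^s$. (ii) (Unconditional energy stability) The inequality $$E(\rho^{n+1},\phi^{n+1})+\frac1{2\tau}d^2(\rho^n,\rho^{n+1})\le E(\rho^n,\phi^n)$$ holds for any $n\ge0$. Furthermore, $$\sum_{n=0}^\infty d^2(\rho^n,\rho^{n+1})\le2\tau\Big(E(\rho^0,\phi^0)-\inf_{(\rho,\phi)\in\mathcal A}E(\rho,\phi)\Big).$$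
   Context: Setting: $\Omega\subset\mathbb{R}^d$ is a bounded domain with Lipschitz boundary and outer unit normal $\mathbf n$; $s\ge1$; $z_i\in\mathbb{R}$; $D_i$ ($i=1,\dots,s$) are continuous and positive on $\overline\Omega$; $\epsilon$ is bounded and measurable with $\epsilon(x)\ge a>0$; $f\in L^2(\Omega)$. The boundary is partitioned disjointly as $\partial\Omega=\Gamma_D\cup\Gamma_N\cup\Gamma_R$ (parts may be empty; a nonempty part has positive surface measure), with time-independent boundary datum $\phi^b\in L^2(\partial\Omega)$ equal to $\phi^b_D=0$ on $\Gamma_D$, $\phi^b_N$ on $\Gamma_N$, $\phi^b_R$ on $\Gamma_R$, and a constant $\beta_R>0$. The boundary condition $\alpha\phi+\beta\epsilon\,\partial\phi/\partial\mathbf n=\phi^b$ uses $(\alpha,\beta)=(1,0)$ on $\Gamma_D$, $(0,1)$ on $\Gamma_N$, $(1,\beta_R)$ on $\Gamma_R$. $\mathcal P(\Omega)$ is the set of probability measures on $\Omega$; in $\rho^{in}$ and in $\mathcal A$ its elements are identified with densities $\rho_i\ge0$, $\int_\Omega\rho_i\,dx=1$. Distance: for $\rho^0,\rho^1\in[\mathcal P(\Omega)]^s$, $$d^2(\rho^0,\rho^1)=\min_{(\rho,u)\in K}\sum_{i=1}^s\int_0^1\int_\Omega D_i^{-1}|u_i|^2\rho_i\,dx\,dt$$ (read as an infimum), where $K$ is the set of $(\rho_1,\dots,\rho_s,u_1,\dots,u_s)$ on $\Omega\times[0,1]$ with $\rho_i(\cdot,t)\in\mathcal P(\Omega)$, $\partial_t\rho_i+\nabla\cdot(\rho_iu_i)=0$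 and $(\rho_iu_i)\cdot\mathbf n=0$ on $\partial\Omega\times[0,1]$ (in the weak sense), $\rho_i(x,0)=\rho_i^0(x)$, $\rho_i(x,1)=\rho_i^1(x)$. Admissible set: $$\mathcal A=\Big\{(\rho,\phi):\ -\nabla\cdot(\epsilon\nabla\phi)=f+\sum_{i=1}^sz_i\rho_i\ \text{in }\Omega,\ \ \alpha\phi+\beta\epsilon\frac{\partial\phi}{\partial\mathbf n}=\phi^b\ \text{on }\partial\Omega,\ \ \rho\in[\mathcal P(\Omega)]^s\Big\},$$ with $\phi\in H^1(\Omega)$ and the Poisson problem understood weakly: $\phi=0$ on $\Gamma_D$, and for all $\eta\in H^1(\Omega)\cap L^\infty(\Omega)$ with $\eta=0$ on $\Gamma_D$, $$\int_\Omega\epsilon\nabla\phi\cdot\nabla\eta\,dx+\frac1{\beta_R}\int_{\Gamma_R}\phi\eta\,ds=\int_\Omega\Big(f+\sum_iz_i\rho_i\Big)\eta\,dx+\int_{\Gamma_N}\phi^b_N\eta\,ds+\frac1{\beta_R}\int_{\Gamma_R}\phi^b_R\eta\,ds.$$ In the pure Neumann case $\partial\Omega=\Gamma_N$ one additionally requires $\int_\Omega\phi\,dx=0$ in $\mathcal A$ and assumes the compatibility condition $\int_\Omega f\,dx+\sum_{i=1}^sz_i+\int_{\partial\Omega}\phi^b\,ds=0$. Energy (values in $(-\infty,+\infty]$, $0\log0=0$): $$E(\rho,\phi)=\int_\Omega\Big(\sum_{i=1}^s\rho_i\log\rho_i+\tfrac12\epsilon|\nabla\phi|^2\Big)dx+\frac1{2\beta_R}\int_{\Gamma_R}\phi^2\,ds.$$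 *)

(* Defs.v *)
From HB Require Import structures.
From mathcomp Require Import all_boot all_order all_algebra.
From mathcomp Require Import all_classical all_reals all_analysis.
Set Implicit Arguments.
Unset Strict Implicit.
Unset Printing Implicit Defensive.
Import Order.TTheory GRing.Theory Num.Theory.
Import numFieldNormedType.Exports.
Local Open Scope classical_set_scope.
Local Open Scope ring_scope.

(* The norm that 'rV[R]_d carries in the library is the sup norm; it induces
   the same topology, but lengths below are Euclidean. *)
Definition dotv (R : realType) (d : nat) (x y : 'rV[R]_d) : R :=
  \sum_(j < d) x ord0 j * y ord0 j.

Definition enorm (R : realType) (d : nat) (x : 'rV[R]_d) : R :=
  Num.sqrt (dotv x x).

Definition ebasis (R : realType) (d : nat) (j : 'I_d) : 'rV[R]_d :=
  delta_mx ord0 j.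

Definition frontier (R : realType) (d : nat) (Omega : set 'rV[R]_d) :
    set 'rV[R]_d :=
  closure Omega `\` interior Omega.

(* In orthonormal coordinates whose last axis is spanned by the unit vector e,
   a point y has last coordinate <y, e> and its remaining coordinates are those
   of y - <y, e> e in the hyperplane orthogonal to e; only the values of g on
   this hyperplane matter. *)
Definition Lipschitz_boundary (R : realType) (d : nat)
    (Omega : set 'rV[R]_d) : Prop :=
  forall x, frontier Omega x ->
    exists (r : R) (e : 'rV[R]_d) (g : 'rV[R]_d -> R) (L : R),
      [/\ 0 < r, enorm e = 1,
          forall y z, `|g y - g z| <= L * enorm (y - z) &
          forall y, enorm (y - x) < r ->
            (Omega y <-> g (y - dotv y e *: e) < dotv y e)].

Section cover_outer_measure.
Context (R : realType) (T : pointedType).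
Local Open Scope ereal_scope.
Variable gauge : set T -> \bar R.
Hypothesis gauge0 : gauge set0 = 0.
Hypothesis gauge_ge0 : forall U, 0 <= gauge U.

Definition cover_outer (X : set T) : \bar R :=
  ereal_inf [set \sum_(k <oo) gauge (F k)
            | F in [set F : (set T)^nat | X `<=` \bigcup_k F k]].

Let Tall := g_sigma_algebraType [set: set T].

Let cover_outerE : cover_outer = @mu_ext _ Tall R gauge.
Proof.
apply/funext => X; rewrite /cover_outer /mu_ext; congr (ereal_inf _).
apply/seteqP; split=> _ [F FX <-]; exists F => //.
  by split => // i; exact: sub_sigma_algebra.
by case: FX.
Qed.

Lemma cover_outer0 : cover_outer set0 = 0.
Proof. by rewrite cover_outerE; exact: mu_ext0. Qed.

Lemma cover_outer_ge0 X : 0 <= cover_outer X.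
Proof. by rewrite cover_outerE; exact: mu_ext_ge0. Qed.

Lemma le_cover_outer : {homo cover_outer : A B / A `<=` B >-> A <= B}.
Proof. by move=> A B AB; rewrite cover_outerE; exact: le_mu_ext. Qed.

Lemma cover_outer_sigma_subadditive : sigma_subadditive cover_outer.
Proof.
by rewrite cover_outerE; exact: (@mu_ext_sigma_subadditive _ Tall R gauge).
Qed.

End cover_outer_measure.

Section lebesgue.
Context (R : realType) (d : nat).
Local Open Scope ereal_scope.

Definition box (a b : 'rV[R]_d) : set 'rV[R]_d :=
  [set x | forall j, (a ord0 j <= x ord0 j <= b ord0 j)%R].

Definition box_gauge (U : set 'rV[R]_d) : \bar R :=
  if U == set0 then 0 else
  ereal_inf [set (\prod_(j < d) (ab.2 ord0 j - ab.1 ord0 j))%:E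
            | ab in [set ab : 'rV[R]_d * 'rV[R]_d |
                (forall j, (ab.1 ord0 j <= ab.2 ord0 j)%R)
                /\ U `<=` box ab.1 ab.2]].

Let box_gauge0 : box_gauge set0 = 0.
Proof. by rewrite /box_gauge eqxx. Qed.

Let box_gauge_ge0 U : 0 <= box_gauge U.
Proof.
rewrite /box_gauge; case: ifP => // _.
apply: le_ereal_inf_tmp => _ [ab [ab_le _] <-]; rewrite lee_fin.
by apply: prodr_ge0 => j _; rewrite subr_ge0.
Qed.

Definition lebesgue_outer : set 'rV[R]_d -> \bar R := cover_outer box_gauge.

HB.instance Definition _ := isOuterMeasure.Build R _ lebesgue_outer
  (cover_outer0 box_gauge0 box_gauge_ge0)
  (cover_outer_ge0 box_gauge_ge0)
  (@le_cover_outer _ _ box_gauge)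
  (cover_outer_sigma_subadditive box_gauge_ge0).

End lebesgue.

Section hausdorff.
Context (R : realType) (m d : nat).
Local Open Scope ereal_scope.

Definition ediam (U : set 'rV[R]_d) : \bar R :=
  ereal_sup [set (enorm (xy.1 - xy.2))%:E | xy in U `*` U].

(* The volume of the unit ball of R^m divided by 2^m: with this factor the
   m-dimensional Hausdorff measure is the m-dimensional surface area. *)
Definition hausdorff_cst : \bar R :=
  lebesgue_outer [set x : 'rV[R]_m | (enorm x <= 1)%R] * (2 ^- m)%:E.

Definition hausdorff_gauge (delta : R) (U : set 'rV[R]_d) : \bar R :=
  if U == set0 then 0 else
  if ediam U <= delta%:E then hausdorff_cst * ediam U ^+ m else +oo.

Let gauge0 delta : hausdorff_gauge delta set0 = 0.
Proof. by rewrite /hausdorff_gauge eqxx. Qed.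

Let gauge_ge0 delta U : 0 <= hausdorff_gauge delta U.
Proof.
rewrite /hausdorff_gauge; case: ifPn => // /set0P[x Ux].
case: ifP => // _; rewrite mule_ge0//.
  by rewrite mule_ge0 ?outer_measure_ge0 ?lee_fin ?invr_ge0 ?exprn_ge0.
have U0 : 0 <= ediam U.
  apply: (@le_trans _ _ (enorm (x - x))%:E); first by rewrite lee_fin sqrtr_ge0.
  by apply: ereal_sup_ubound; exists (x, x).
by rewrite expe_ge0.
Qed.

Definition hausdorff_outer (X : set 'rV[R]_d) : \bar R :=
  ereal_sup [set cover_outer (hausdorff_gauge delta) X
            | delta in [set delta : R | (0 < delta)%R]].

Let hausdorff_outer_ge0 X : 0 <= hausdorff_outer X.
Proof.
apply: (@le_trans _ _ (cover_outer (hausdorff_gauge 1%R) X)).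
  exact: cover_outer_ge0.
by apply: ereal_sup_ubound; exists 1%R => /=.
Qed.

Let hausdorff_outer0 : hausdorff_outer set0 = 0.
Proof.
apply/eqP; rewrite eq_le hausdorff_outer_ge0 andbT.
by apply: ge_ereal_sup => _ [delta _ <-]; rewrite cover_outer0.
Qed.

Let le_hausdorff_outer : {homo hausdorff_outer : A B / A `<=` B >-> A <= B}.
Proof.
move=> A B AB; apply: ge_ereal_sup => _ [delta delta0 <-].
apply: (le_trans (le_cover_outer (hausdorff_gauge delta) AB)).
by apply: ereal_sup_ubound; exists delta.
Qed.

Let hausdorff_outer_sigma_subadditive : sigma_subadditive hausdorff_outer.
Proof.
move=> A; apply: ge_ereal_sup => _ [delta delta0 <-].
apply: (le_trans (cover_outer_sigma_subadditive (gauge_ge0 delta) A)).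
apply: lee_nneseries => [i _ _|i _]; first exact: cover_outer_ge0.
by apply: ereal_sup_ubound; exists delta.
Qed.

HB.instance Definition _ := isOuterMeasure.Build R _ hausdorff_outer
  hausdorff_outer0 hausdorff_outer_ge0
  le_hausdorff_outer hausdorff_outer_sigma_subadditive.

End hausdorff.

Definition leb_outer (R : realType) (d : nat) :
  {outer_measure set 'rV[R]_d -> \bar R} := @lebesgue_outer R d.

Definition surf_outer (R : realType) (d : nat) :
  {outer_measure set 'rV[R]_d -> \bar R} := @hausdorff_outer R d.-1 d.

(* Aliases of 'rV[R]_d: lebRd carries the sigma-algebra of Lebesgue measurable
   sets, surfRd that of the H^(d-1)-measurable sets, borelRd the Borel sets. *)
Notation lebRd R d := (caratheodory_type (leb_outer R d)).
Notation surfRd R d := (caratheodory_type (surf_outer R d)).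
Notation borelRd R d := (g_sigma_algebraType (@open 'rV[R]_d)).

Definition leb (R : realType) (d : nat) : {measure set (lebRd R d) -> \bar R} :=
  leb_outer R d : set (lebRd R d) -> \bar R.

Definition surf (R : realType) (d : nat) :
    {measure set (surfRd R d) -> \bar R} :=
  surf_outer R d : set (surfRd R d) -> \bar R.

Definition L2 (disp : measure_display) (T : measurableType disp)
    (R : realType) (mu : {measure set T -> \bar R}) (A : set T) (f : T -> R) :
    Prop :=
  measurable_fun A f /\ mu.-integrable A (fun x => (f x ^+ 2)%:E).

Definition Linfty (disp : measure_display) (T : measurableType disp)
    (R : realType) (mu : {measure set T -> \bar R}) (A : set T) (f : T -> R) :
    Prop :=
  measurable_fun A f /\
  exists M : R, {ae mu, forall x, A x -> `|f x| <= M}.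

Section sobolev.
Context (R : realType) (d : nat).
Implicit Types (f phi : 'rV[R]_d -> R) (Omega : set 'rV[R]_d).

Fixpoint Ck (k : nat) (f : 'rV[R]_d -> R) : Prop :=
  continuous f /\
  if k is k'.+1 then
    forall j : 'I_d, (forall x, derivable f x (ebasis R j)) /\
                     Ck k' (fun x => 'D_(ebasis R j) f x)
  else True.

Definition grad f (x : 'rV[R]_d) : 'rV[R]_d :=
  \row_(j < d) 'D_(ebasis R j) f x.

Definition Cc_infty Omega f : Prop :=
  (forall k, Ck k f) /\
  exists K : set 'rV[R]_d,
    [/\ compact K, K `<=` Omega & forall x, ~ K x -> f x = 0].

Definition is_weak_gradient Omega phi (g : 'rV[R]_d -> 'rV[R]_d) : Prop :=
  forall j : 'I_d, L2 (leb R d) Omega (fun x => g x ord0 j) /\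
    forall psi, Cc_infty Omega psi ->
      \int[leb R d]_(x in Omega) (phi x * 'D_(ebasis R j) psi x) =
      - \int[leb R d]_(x in Omega) (g x ord0 j * psi x).

Definition H1 Omega phi : Prop :=
  L2 (leb R d) Omega phi /\ exists g, is_weak_gradient Omega phi g.

(* Unique up to a null set when phi is in H^1(Omega). *)
Definition weak_gradient Omega phi : 'rV[R]_d -> 'rV[R]_d :=
  xget (fun=> 0) [set g | is_weak_gradient Omega phi g].

(* The trace operator is the extension by continuity to H^1(Omega) of the
   restriction to the boundary of the functions that are C^1 up to it. *)
Definition is_trace Omega phi (T : 'rV[R]_d -> R) : Prop :=
  L2 (surf R d) (frontier Omega) T /\
  exists phik : nat -> 'rV[R]_d -> R,
    [/\ forall k, Ck 1 (phik k),
        (\int[leb R d]_(x in Omega) ((phik k x - phi x) ^+ 2)%:E)%E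
          @[k --> \oo] --> 0%E,
        (\int[leb R d]_(x in Omega)
            (enorm (grad (phik k) x - weak_gradient Omega phi x) ^+ 2)%:E)%E
          @[k --> \oo] --> 0%E &
        (\int[surf R d]_(x in frontier Omega) ((phik k x - T x) ^+ 2)%:E)%E
          @[k --> \oo] --> 0%E].

Definition trace Omega phi : 'rV[R]_d -> R :=
  xget (fun=> 0) [set T | is_trace Omega phi T].

End sobolev.

(* The boundary data phi_D, phi_N, phi_R are the restrictions of phib. *)
Record model (R : realType) (d s : nat) := Model {
  Omega : set 'rV[R]_d;
  valence : 'I_s -> R;
  diffusion : 'I_s -> 'rV[R]_d -> R;
  permittivity : 'rV[R]_d -> R;
  fixed_charge : 'rV[R]_d -> R;
  GammaD : set 'rV[R]_d;
  GammaN : set 'rV[R]_d;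
  GammaR : set 'rV[R]_d;
  phib : 'rV[R]_d -> R;
  betaR : R
}.

Record assumptions (R : realType) (d s : nat) (P : model R d s) : Prop := {
  d_gt0 : (0 < d)%N;
  s_gt0 : (0 < s)%N;
  Omega_open : open (Omega P);
  Omega_connected : connected (Omega P);
  Omega_nonempty : Omega P !=set0;
  Omega_bounded : bounded_set (Omega P);
  Omega_Lipschitz : Lipschitz_boundary (Omega P);
  diffusion_continuous : forall i : 'I_s,
    {within closure (Omega P), continuous (diffusion P i)};
  diffusion_gt0 : forall (i : 'I_s) x,
    closure (Omega P) x -> 0 < diffusion P i x;
  permittivity_measurable :
    measurable_fun (Omega P : set (lebRd R d)) (permittivity P);
  permittivity_bounded : exists M : R,
    forall x, Omega P x -> `|permittivity P x| <= M;
  permittivity_coercive : exists2 a : R, 0 < a &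
    forall x, Omega P x -> a <= permittivity P x;
  fixed_charge_L2 : L2 (leb R d) (Omega P) (fixed_charge P);
  Gamma_cover : GammaD P `|` GammaN P `|` GammaR P = frontier (Omega P);
  GammaDN_disjoint : GammaD P `&` GammaN P = set0;
  GammaDR_disjoint : GammaD P `&` GammaR P = set0;
  GammaNR_disjoint : GammaN P `&` GammaR P = set0;
  GammaD_measurable : measurable (GammaD P : set (surfRd R d));
  GammaN_measurable : measurable (GammaN P : set (surfRd R d));
  GammaR_measurable : measurable (GammaR P : set (surfRd R d));
  GammaD_gt0 : GammaD P !=set0 -> (0 < surf R d (GammaD P))%E;
  GammaN_gt0 : GammaN P !=set0 -> (0 < surf R d (GammaN P))%E;
  GammaR_gt0 : GammaR P !=set0 -> (0 < surf R d (GammaR P))%E;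
  phib_L2 : L2 (surf R d) (frontier (Omega P)) (phib P);
  phib_GammaD : {ae surf R d, forall x, GammaD P x -> phib P x = 0};
  betaR_gt0 : 0 < betaR P;
  compatibility : GammaN P = frontier (Omega P) ->
    \int[leb R d]_(x in Omega P) fixed_charge P x
    + \sum_(i < s) valence P i
    + \int[surf R d]_(x in frontier (Omega P)) phib P x = 0
}.

Section scheme.
Context (R : realType) (d s : nat) (P : model R d s).
Implicit Types (rho : 'I_s -> 'rV[R]_d -> R) (phi : 'rV[R]_d -> R).

Definition prob_density (r : 'rV[R]_d -> R) : Prop :=
  [/\ measurable_fun (Omega P : set (lebRd R d)) r,
      forall x, Omega P x -> 0 <= r x &
      (\int[leb R d]_(x in Omega P) (r x)%:E = 1)%E].

(* The measure on the Borel sets that is identified with the density r. *)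
Definition density_measure (r : 'rV[R]_d -> R) (B : set 'rV[R]_d) : \bar R :=
  (\int[leb R d]_(x in Omega P `&` B) (r x)%:E)%E.

Section transport.

(* mu i t is the i-th probability measure at time t and u i t x the i-th
   velocity; only times in [0, 1] matter.  The weak form of the continuity
   equation uses test functions that need not vanish on the boundary, which
   encodes the no-flux condition. *)
Definition transport_path (mu0 mu1 : 'I_s -> set 'rV[R]_d -> \bar R)
    (mu : 'I_s -> R.-pker R ~> borelRd R d)
    (u : 'I_s -> R -> 'rV[R]_d -> 'rV[R]_d) : Prop :=
  forall i : 'I_s,
  [/\ forall t, 0 <= t <= 1 -> (mu i t (Omega P) = 1)%E,
      forall B : set (borelRd R d), measurable B ->
        mu i 0 B = mu0 i B /\ mu i 1 B = mu1 i B,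
      forall j : 'I_d,
        measurable_fun (`[0, 1]%classic `*` Omega P : set (R * borelRd R d))
          (fun tx => u i tx.1 tx.2 ord0 j),
      (\int[lebesgue_measure]_(t in `[0%R, 1%R])
         \int[mu i t]_(x in Omega P) (enorm (u i t x))%:E < +oo)%E &
      forall psi : 'rV[R]_d -> R, Ck 1 psi -> forall t, 0 <= t <= 1 ->
        \int[mu i t]_(x in Omega P) psi x
        - \int[mu i 0]_(x in Omega P) psi x =
        \int[lebesgue_measure]_(r in `[0, t])
           (\int[mu i r]_(x in Omega P) dotv (grad psi x) (u i r x))].

Definition action (mu : 'I_s -> R.-pker R ~> borelRd R d)
    (u : 'I_s -> R -> 'rV[R]_d -> 'rV[R]_d) : \bar R :=
  (\sum_(i < s) \int[lebesgue_measure]_(t in `[0%R, 1%R])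
     \int[mu i t]_(x in Omega P)
        ((diffusion P i x)^-1 * enorm (u i t x) ^+ 2)%:E)%E.

Definition dist2 (mu0 mu1 : 'I_s -> set 'rV[R]_d -> \bar R) : \bar R :=
  ereal_inf [set action muu.1 muu.2
            | muu in [set muu | transport_path mu0 mu1 muu.1 muu.2]].

End transport.

Definition d2 rho0 rho1 : \bar R :=
  dist2 (fun i => density_measure (rho0 i)) (fun i => density_measure (rho1 i)).

Definition weak_Poisson rho phi : Prop :=
  [/\ H1 (Omega P) phi,
      {ae surf R d, forall x, GammaD P x -> trace (Omega P) phi x = 0} &
      forall eta : 'rV[R]_d -> R,
        H1 (Omega P) eta -> Linfty (leb R d) (Omega P) eta ->
        {ae surf R d, forall x, GammaD P x -> trace (Omega P) eta x = 0} ->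
        \int[leb R d]_(x in Omega P)
           (permittivity P x * dotv (weak_gradient (Omega P) phi x)
                                    (weak_gradient (Omega P) eta x))
        + (betaR P)^-1 * \int[surf R d]_(x in GammaR P)
           (trace (Omega P) phi x * trace (Omega P) eta x) =
        \int[leb R d]_(x in Omega P)
           ((fixed_charge P x + \sum_(i < s) valence P i * rho i x) * eta x)
        + \int[surf R d]_(x in GammaN P) (phib P x * trace (Omega P) eta x)
        + (betaR P)^-1 * \int[surf R d]_(x in GammaR P)
           (phib P x * trace (Omega P) eta x)].

Definition admissible :
    set (('I_s -> 'rV[R]_d -> R) * ('rV[R]_d -> R)) :=
  [set v | [/\ weak_Poisson v.1 v.2,
               forall i, prob_density (v.1 i) &
               GammaN P = frontier (Omega P) ->
                 \int[leb R d]_(x in Omega P) v.2 x = 0]].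

(* [ln 0 = 0], so [r * ln r] vanishes at [r = 0]. *)
Definition energy rho phi : \bar R :=
  (\int[leb R d]_(x in Omega P)
     (\sum_(i < s) rho i x * ln (rho i x)
      + 2^-1 * permittivity P x
        * enorm (weak_gradient (Omega P) phi x) ^+ 2)%:E
   + ((2 * betaR P)^-1)%:E
     * \int[surf R d]_(x in GammaR P) (trace (Omega P) phi x ^+ 2)%:E)%E.

Definition objective (tau : R) (rho_old : 'I_s -> 'rV[R]_d -> R)
    (v : ('I_s -> 'rV[R]_d -> R) * ('rV[R]_d -> R)) : \bar R :=
  (((2 * tau)^-1)%:E * d2 rho_old v.1 + energy v.1 v.2)%E.

End scheme.

Definition is_argmin (R : realType) (T : Type) (A : set T) (J : T -> \bar R)
    (v : T) : Prop :=
  A v /\ forall w, A w -> (J v <= J w)%E.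

(* Main.v *)
Require Import Defs.
From HB Require Import structures.
From mathcomp Require Import all_boot all_order all_algebra.
From mathcomp Require Import all_classical all_reals all_analysis.
Set Implicit Arguments.
Unset Strict Implicit.
Unset Printing Implicit Defensive.
Import Order.TTheory GRing.Theory Num.Theory.
Import numFieldNormedType.Exports.
Local Open Scope classical_set_scope.
Local Open Scope ring_scope.

(** Minimality of the iterate n+1 is only compared with one competitor, the
    previous iterate itself.  It is admissible, so the energy inequality is
    exactly the minimality inequality once the distance from a state to itself
    is known to vanish.  Summing the energy inequality, the energies telescope:
    every partial sum of the squared distances is at most 2 tau times the
    energy lost so far, hence at most 2 tau times the gap between the initial
    energy and the infimum ([nneseries_dissipation_le]).  That each iterate
    consists of probability densities is part of admissibility.

    The distance from a state to itself vanishes because the path that stays at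
    the initial state with zero velocity has zero action ([d2_self_le0]).  The
    only work is to see that this path is a path of Borel probability measures.
    A density is integrated against the Lebesgue measure, which is defined on
    the Caratheodory measurable sets of the outer measure generated by boxes,
    so one needs Borel sets to be measurable in that sense
    ([borel_lebesgue_measurable]).  The key point is that a half-space
    orthogonal to a coordinate axis cuts a box into two boxes whose volumes add
    up to the volume of the box ([box_gauge_split]). *)

(** The discrete energy-dissipation argument, for energies that may be
    infinite.  If the initial energy is +oo or the lower bound m is -oo, the
    dual subtraction makes the right-hand side +oo; otherwise both are finite
    and the telescoped inequality can be rearranged. *)
Lemma nneseries_dissipation_le (R : realType) (c : R) (D e : nat -> \bar R)
    (m : \bar R) :
  0 < c -> (forall n, 0 <= D n)%E ->
  (forall n, e n.+1 + (c^-1)%:E * D n <= e n)%E -> (forall n, m <= e n)%E ->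
  (\sum_(0 <= n <oo) D n <= c%:E * (e 0%N - m)%dE)%E.
Proof.
move=> c0 D0 eD me.
have partial N : (e N + (c^-1)%:E * \sum_(0 <= n < N) D n <= e 0%N)%E.
  elim: N => [|N IH]; first by rewrite big_nil mule0 adde0.
  apply: le_trans IH; rewrite big_nat_recr//= ge0_muleDr ?sume_ge0//.
  by rewrite addeCA addeC leeD2r.
move: (me 0%N) partial; case: (e 0%N) => [a| |].
- case: m me => [r|//|] me; last first.
    by move=> _ _; rewrite /= mulry gtr0_sg// mul1e leey.
  move=> ra partial; apply: lime_le; first exact: is_cvg_nneseries.
  apply: nearW => N; rewrite muleC -lee_pdivrMr//.
  rewrite muleC (_ : (a%:E - r%:E)%dE = (a%:E - r%:E)%E)// leeBrDl//.
  by apply: le_trans (partial N); exact: leeD2r.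
- by case: m me => [r| |] _ _ _; rewrite /= mulry gtr0_sg// mul1e leey.
- by rewrite leeNy_eq => /eqP -> _; rewrite /= mulry gtr0_sg// mul1e leey.
Qed.

Section borel.
Context (R : realType) (d : nat).

Local Open Scope ereal_scope.

Lemma box_gauge_le (a b : 'rV[R]_d) (U : set 'rV[R]_d) :
  (forall j, a ord0 j <= b ord0 j)%R -> U `<=` box a b ->
  box_gauge U <= (\prod_(j < d) (b ord0 j - a ord0 j))%:E.
Proof.
move=> ab Uab; rewrite /box_gauge; case: ifP => _.
  by rewrite lee_fin prodr_ge0// => j _; rewrite subr_ge0.
by apply: ereal_inf_lbound; exists (a, b).
Qed.

Lemma box_gauge_ge0 (U : set 'rV[R]_d) : 0 <= box_gauge U.
Proof.
rewrite /box_gauge; case: ifP => // _.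
apply: le_ereal_inf_tmp => _ [ab [ab_le _] <-]; rewrite lee_fin.
by apply: prodr_ge0 => j _; rewrite subr_ge0.
Qed.

(** A cut orthogonal to the axis i replaces one factor of the volume of a box by
    two factors with the same sum. *)
Lemma box_gauge_split (i : 'I_d) (c : R) (U : set 'rV[R]_d) :
  box_gauge (U `&` [set x | x ord0 i < c]%R) +
  box_gauge (U `&` ~` [set x | x ord0 i < c]%R) <= box_gauge U.
Proof.
set H := [set x | _]; have [->|U0] := eqVneq U set0.
  by rewrite !set0I /box_gauge eqxx adde0.
rewrite [leRHS]/box_gauge (negbTE U0).
apply: le_ereal_inf_tmp => _ [[a b]/= [ab Uab] <-].
(* The cut position is clamped to the side of the box, so that a cut that misses
   the box gives the box itself and a degenerate box. *)
pose m := Num.max (a ord0 i) (Num.min (b ord0 i) c).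
have am : (a ord0 i <= m)%R by rewrite le_max lexx.
have mb : (m <= b ord0 i)%R by rewrite ge_max ab ge_min lexx.
pose b' : 'rV[R]_d := \row_j (if j == i then m else b ord0 j).
pose a' : 'rV[R]_d := \row_j (if j == i then m else a ord0 j).
have vol : (\prod_(j < d) (b ord0 j - a ord0 j) =
    \prod_(j < d) (b' ord0 j - a ord0 j) +
    \prod_(j < d) (b ord0 j - a' ord0 j))%R.
  rewrite [LHS](bigD1 i)//= [X in _ = (X + _)%R](bigD1 i)//=.
  rewrite [X in _ = (_ + X)%R](bigD1 i)//= !mxE eqxx.
  under [X in (_ = _ * X + _)%R]eq_bigr => j /negbTE ji do rewrite mxE ji.
  under [X in (_ = _ + _ * X)%R]eq_bigr => j /negbTE ji do rewrite mxE ji.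
  by rewrite -mulrDl [X in (_ = X * _)%R]addrC addrA subrK.
rewrite vol EFinD; apply: leeD; apply: box_gauge_le.
- by move=> j; rewrite mxE; case: eqP => [->|].
- move=> x [/Uab xab /= xc] j; have /andP[-> xb] := xab j; rewrite mxE /=.
  case: eqP => // ji; rewrite ji in xb *.
  by rewrite le_max le_min xb (ltW xc) orbT.
- by move=> j; rewrite mxE; case: eqP => [->|].
- move=> x [/Uab xab /= /negP]; rewrite -leNgt => cx j.
  have /andP[ax ->] := xab j; rewrite mxE andbT.
  by case: eqP => // ji; rewrite ji in ax *; rewrite ge_max ax ge_min cx orbT.
Qed.

(** Cutting every set of a cover along the hyperplane gives covers of the two
    parts of a test set, without increasing the total gauge. *)
Lemma measurable_lower_halfspace (i : 'I_d) (c : R) :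
  measurable ([set x : 'rV[R]_d | (x ord0 i < c)%R] : set (lebRd R d)).
Proof.
apply: (@le_caratheodory_measurable R _ (leb_outer R d)) => X.
set H := [set x | _]; apply: le_ereal_inf_tmp => _ [F XF <-].
apply: (@le_trans _ _ (\sum_(k <oo) (box_gauge (F k `&` H) +
                                     box_gauge (F k `&` ~` H)))).
  rewrite nneseriesD; try by move=> *; exact: box_gauge_ge0.
  apply: leeD; apply: ereal_inf_lbound.
  - by exists (fun k => F k `&` H) => // x [/XF[k _ Fx] Hx]; exists k.
  - by exists (fun k => F k `&` ~` H) => // x [/XF[k _ Fx] Hx]; exists k.
apply: lee_nneseries => [k _ _|k _]; last exact: box_gauge_split.
by rewrite adde_ge0 ?box_gauge_ge0.
Qed.

Local Open Scope ring_scope.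

Lemma measurable_upper_halfspace (i : 'I_d) (c : R) :
  measurable ([set x : 'rV[R]_d | c < x ord0 i] : set (lebRd R d)).
Proof.
rewrite (_ : [set _ | _] = \bigcup_(k : nat)
    ~` [set x : 'rV[R]_d | x ord0 i < c + k.+1%:R^-1]); last first.
  apply/seteqP; split=> x /=.
    rewrite -subr_gt0 => /ltr_add_invr[k]; rewrite add0r => kx.
    by exists k => //=; apply/negP; rewrite -leNgt -lerBrDl ltW.
  move=> [k _ /= /negP]; rewrite -leNgt; apply: lt_le_trans.
  by rewrite ltrDl invr_gt0.
by apply: bigcupT_measurable => k; apply/measurableC/measurable_lower_halfspace.
Qed.

Definition rat_box (pq : 'rV[rat]_d * 'rV[rat]_d) : set 'rV[R]_d :=
  \bigcap_(j : 'I_d) ([set x | ratr (pq.1 ord0 j) < x ord0 j] `&`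
                      [set x | x ord0 j < ratr (pq.2 ord0 j)]).

Lemma measurable_rat_box pq : measurable (rat_box pq : set (lebRd R d)).
Proof.
apply: fin_bigcap_measurable; first exact: finite_finset.
move=> j _; apply: measurableI; first exact: measurable_upper_halfspace.
exact: measurable_lower_halfspace.
Qed.

(** Density of the rationals, applied to each side of a cube centred at the
    given point. *)
Lemma open_bigcup_rat_box (U : set 'rV[R]_d) : open U ->
  U = \bigcup_(pq in [set pq | rat_box pq `<=` U]) rat_box pq.
Proof.
move=> oU; apply/seteqP; split=> [x Ux|x [pq /= pqU /pqU//]].
(* Balls are cubes here: the norm of row vectors is the sup norm. *)
have /nbhs_ballP[e /= e0 xeU] : nbhs x U by exact: open_nbhs_nbhs.
have /choice[p hp] j : exists q : rat, ratr q \in `]x ord0 j - e, x ord0 j[.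
  by apply: rat_in_itvoo; rewrite gtrBl.
have /choice[q hq] j : exists q : rat, ratr q \in `]x ord0 j, x ord0 j + e[.
  by apply: rat_in_itvoo; rewrite ltrDl.
exists (\row_j p j, \row_j q j) => /= [y By|j _ /=]; last first.
  rewrite !mxE; move: (hp j) (hq j); rewrite !in_itv/=.
  by move=> /andP[_ ->] /andP[->].
apply: xeU; split=> // i j; rewrite (ord1 i).
have [/= + +] := By j I; rewrite !mxE => py yq.
move: (hp j) (hq j); rewrite !in_itv/= => /andP[ep _] /andP[_ qe].
rewrite /ball/= ltr_distlC; apply/andP; split; first exact: lt_trans ep py.
exact: lt_trans yq qe.
Qed.

(** Half-spaces generate the Borel sets, since an open set is a union of boxes
    with rational corners, of which there are countably many. *)
Lemma borel_lebesgue_measurable (B : set 'rV[R]_d) :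
  measurable (B : set (borelRd R d)) -> measurable (B : set (lebRd R d)).
Proof.
move: B; apply: smallest_sub.
  exact: (@sigma_algebra_measurable _ (lebRd R d)).
move=> U /open_bigcup_rat_box ->; rewrite bigcup_mkcond.
apply: (@countable_bigcupT_measurable _ (lebRd R d)) => [|pq].
  exact: countableP.
case: ifP => _; [exact: measurable_rat_box | exact: measurable0].
Qed.

End borel.

Section density.
Context (R : realType) (d s : nat) (P : model R d s).
Hypothesis oOmega : open (Omega P).
Variable r : 'rV[R]_d -> R.
Hypothesis hr : prob_density P r.
Local Open Scope ereal_scope.

(** An alias of [density_measure] on the Borel sigma-algebra, to which the
    measure and probability structures are attached. *)
Definition borel_density : set (borelRd R d) -> \bar R := density_measure P r.

Let mOmega : measurable (Omega P : set (lebRd R d)).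
Proof. by apply: borel_lebesgue_measurable; exact: sub_sigma_algebra. Qed.

Let borel_density0 : borel_density set0 = 0.
Proof. by rewrite /borel_density /density_measure setI0 integral_set0. Qed.

Let borel_density_ge0 B : 0 <= borel_density B.
Proof.
by apply: integral_ge0 => x [Ox _]; rewrite lee_fin; case: hr => _ + _; exact.
Qed.

Let borel_density_sigma_additive : semi_sigma_additive borel_density.
Proof.
move=> F mF tF mUF; rewrite /borel_density /density_measure setI_bigcupr.
have mOF k : measurable (Omega P `&` F k : set (lebRd R d)).
  by apply: measurableI => //; exact: borel_lebesgue_measurable.
case: hr => mr r0 _.
rewrite ge0_integral_bigcup//.
- by apply: is_cvg_nneseries => k _ _; exact: borel_density_ge0.
- apply: (@measurable_funS _ _ (lebRd R d) _ (Omega P)) => //.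
    by move=> x [k _ []].
  exact/measurable_realfun.measurable_EFinP.
- by move=> x [k _ [Ox _]]; rewrite lee_fin r0.
- exact: trivIset_setIl.
Qed.

HB.instance Definition _ := isMeasure.Build _ _ _ borel_density
  borel_density0 borel_density_ge0 borel_density_sigma_additive.

Let borel_density_setT : borel_density setT = 1.
Proof. by rewrite /borel_density /density_measure setIT; case: hr. Qed.

HB.instance Definition _ :=
  Measure_isProbability.Build _ _ _ borel_density borel_density_setT.

Definition static_kernel : R.-pker R ~> borelRd R d :=
  kprobability (@measurable_cst _ _ R _ setT
     (borel_density : pprobability (borelRd R d) R)).

End density.

Lemma enorm0 (R : realType) (d : nat) : enorm (0 : 'rV[R]_d) = 0%R.
Proof.
by rewrite /enorm /dotv big1 ?sqrtr0// => j _; rewrite mxE mulr0.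
Qed.

Section transport_cost.
Context (R : realType) (d s : nat) (P : model R d s).
Hypothesis hP : assumptions P.
Local Open Scope ereal_scope.

Lemma d2_ge0 rho0 rho1 : 0 <= d2 P rho0 rho1.
Proof.
apply: le_ereal_inf_tmp => _ [[mu u] _ <-] /=; apply: sume_ge0 => i _.
apply: integral_ge0 => t _; apply: integral_ge0 => x Ox.
rewrite lee_fin mulr_ge0 ?sqr_ge0// invr_ge0 ltW//.
by apply: diffusion_gt0 => //; exact: subset_closure.
Qed.

(** The competitor is the static path with zero velocity, for which both sides
    of the continuity equation vanish. *)
Lemma d2_self_le0 rho : (forall i, prob_density P (rho i)) ->
  d2 P rho rho <= 0.
Proof.
move=> hrho; apply: ge_ereal_inf; exists 0 => //=.
pose mu i := static_kernel (Omega_open hP) (hrho i).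
exists (mu, fun _ _ _ => 0%R) => /=.
  move=> i; split => //.
  - move=> t _; rewrite /= /borel_density /density_measure setIid.
    by case: (hrho i).
  - rewrite [ltLHS](_ : _ = 0) ?ltry//; apply: integral0_eq => t _.
    by apply: integral0_eq => x _; rewrite enorm0.
  - move=> psi _ t _; rewrite [in LHS]/= subrr; apply/esym.
    rewrite /Rintegral [X in fine X](_ : _ = 0)//.
    apply: integral0_eq => r _; rewrite [X in fine X](_ : _ = 0)//.
    apply: integral0_eq => x _; rewrite /dotv big1// => j _.
    by rewrite [X in (_ * X)%R]mxE mulr0.
rewrite /action big1// => i _.
apply: integral0_eq => t _; apply: integral0_eq => x _.
by rewrite enorm0 expr0n/= mulr0.
Qed.

End transport_cost.

Theorem theorem2p4 (R : realType) (d s : nat) (P : model R d s)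
    (hP : assumptions P) (tau : R) (tau_gt0 : 0 < tau)
    (rhoin : 'I_s -> 'rV[R]_d -> R)
    (rhoinP : forall i, prob_density P (rhoin i))
    (rho : nat -> 'I_s -> 'rV[R]_d -> R) (phi : nat -> 'rV[R]_d -> R)
    (rho0 : rho 0%N = rhoin)
    (adm0 : admissible P (rho 0%N, phi 0%N))
    (step : forall n : nat,
      is_argmin (admissible P) (objective P tau (rho n))
        (rho n.+1, phi n.+1)) :
  [/\ forall n : nat, (forall i, prob_density P (rho n i)) ->
        forall i, prob_density P (rho n.+1 i),
      forall n : nat,
        (energy P (rho n.+1) (phi n.+1)
         + ((2 * tau)^-1)%:E * d2 P (rho n) (rho n.+1)
         <= energy P (rho n) (phi n))%E &
      (\sum_(0 <= n <oo) d2 P (rho n) (rho n.+1)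
       <= (2 * tau)%:E *
          (energy P (rho 0%N) (phi 0%N)
           - ereal_inf [set energy P v.1 v.2 | v in admissible P])%dE)%E].
Proof.
have adm n : admissible P (rho n, phi n) by case: n => [//|n]; case: (step n).
have prob n i : prob_density P (rho n i) by case: (adm n) => _ /(_ i).
have stable n : (energy P (rho n.+1) (phi n.+1)
    + ((2 * tau)^-1)%:E * d2 P (rho n) (rho n.+1)
    <= energy P (rho n) (phi n))%E.
  have [_ /(_ _ (adm n))] := step n; rewrite /objective /= addeC.
  have -> : d2 P (rho n) (rho n) = 0%E.
    by apply/eqP; rewrite eq_le d2_ge0// d2_self_le0.
  by rewrite mule0 add0e.
split => //.
apply: (nneseries_dissipation_le (e := fun n => energy P (rho n) (phi n))) => //.
- by rewrite mulr_gt0.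
- by move=> n; exact: d2_ge0.
- by move=> n; apply: ereal_inf_lbound; exists (rho n, phi n).
Qed.
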